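(* For every integer $m\ge1$, let $$\mathbf c_1(m)=(m+4,-(m+1),-1,-1),\quad \mathbf c_2(m)=(-(m+1),-3,-1,m+4),\quad \mathbf c_3(m)=(-1,m+3,-(m+1),-1),$$ let $L(m)=\mathbb Z\mathbf c_1(m)+\mathbb Z\mathbf c_2(m)+\mathbb Z\mathbf c_3(m)\subseteq\mathbb Z^4$, and let $$n_1(m)=m^3+7m^2+21m+20,\quad n_2(m)=m^3+8m^2+25m+25,$$ $$n_3(m)=m^3+8m^2+26m+25,\quad n_4(m)=m^3+8m^2+28m+30.$$ Then the following hold. (i) $\gcd(n_1(m),n_2(m),n_3(m),n_4(m))$ equals $5$ if $5$ divides $m$, and equals $1$ otherwise. (ii) The lattice $L(m)$ has admissible basis $\{\mathbf c_1(m),\mathbf c_2(m),\mathbf c_3(m)\}$. (iii) If $5$ does not divide $m$, then $L(m)=\ker_{\mathbb Z}(n_1(m),n_2(m),n_3(m),n_4(m))$.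
   Context: For positive integers $n_1,\dots,n_4$, $\ker_{\mathbb Z}(n_1,\dots,n_4)=\{(u_1,\dots,u_4)\in\mathbb Z^4\mid u_1n_1+\cdots+u_4n_4=0\}$. A $\mathbb Z$-basis $\{\mathbf c_1,\mathbf c_2,\mathbf c_3\}$ of a rank-three lattice $L\subseteq\mathbb Z^4$ is admissible if $\mathbf c_1=(\alpha_{11},-\alpha_{12},-\alpha_{13},-\alpha_{14})$, $\mathbf c_2=(-\alpha_{21},-\alpha_{22},-\alpha_{23},\alpha_{24})$, $\mathbf c_3=(-\alpha_{31},\alpha_{32},-\alpha_{33},-\alpha_{34})$ with every $\alpha_{ij}$ a positive integer, and: (I) $\alpha_{11}>\alpha_{21}+2\alpha_{31}$; (II) $\max(\alpha_{12},\alpha_{22})<\alpha_{32}<\alpha_{12}+\alpha_{22}$; (III) $\alpha_{24}>\alpha_{14}+2\alpha_{34}$. *)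

(* Defs.v *)
From mathcomp Require Import all_boot all_order all_algebra.

Set Implicit Arguments.
Unset Strict Implicit.
Unset Printing Implicit Defensive.

Import Order.TTheory GRing.Theory Num.Theory.
Local Open Scope ring_scope.

Definition vec4 (x1 x2 x3 x4 : int) : 'rV[int]_4 :=
  \row_(j < 4) [:: x1; x2; x3; x4]`_j.

Definition kerZ (n1 n2 n3 n4 : int) (u : 'rV[int]_4) : Prop :=
  \sum_(j < 4) u 0 j * vec4 n1 n2 n3 n4 0 j = 0.

(* Sublattices of Z^4 are represented by their membership predicate. *)
Definition isZbasis (r : nat) (L : 'rV[int]_4 -> Prop)
    (c : r.-tuple 'rV[int]_4) : Prop :=
  (forall v, L v <-> inIntSpan c v) /\
  (forall a : int ^ r, \sum_(i < r) c`_i *~ a i = 0 -> forall i, a i = 0).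

Definition admissible_basis (L : 'rV[int]_4 -> Prop)
    (c1 c2 c3 : 'rV[int]_4) : Prop :=
  isZbasis L [tuple c1; c2; c3] /\
  exists a11 a12 a13 a14 a21 a22 a23 a24 a31 a32 a33 a34 : int,
    [/\ all (fun a => 0 < a)
          [:: a11; a12; a13; a14; a21; a22; a23; a24; a31; a32; a33; a34],
        [/\ c1 = vec4 a11 (- a12) (- a13) (- a14),
            c2 = vec4 (- a21) (- a22) (- a23) a24 &
            c3 = vec4 (- a31) a32 (- a33) (- a34)],
        a11 > a21 + 2 * a31,
        Num.max a12 a22 < a32 < a12 + a22 &
        a24 > a14 + 2 * a34].

Definition c1 (m : int) : 'rV[int]_4 := vec4 (m + 4) (- (m + 1)) (- 1) (- 1).
Definition c2 (m : int) : 'rV[int]_4 := vec4 (- (m + 1)) (- 3) (- 1) (m + 4).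
Definition c3 (m : int) : 'rV[int]_4 := vec4 (- 1) (m + 3) (- (m + 1)) (- 1).

Definition latL (m : int) : 'rV[int]_4 -> Prop :=
  inIntSpan [tuple c1 m; c2 m; c3 m].

Definition n1 (m : int) : int := m ^+ 3 + 7 * m ^+ 2 + 21 * m + 20.
Definition n2 (m : int) : int := m ^+ 3 + 8 * m ^+ 2 + 25 * m + 25.
Definition n3 (m : int) : int := m ^+ 3 + 8 * m ^+ 2 + 26 * m + 25.
Definition n4 (m : int) : int := m ^+ 3 + 8 * m ^+ 2 + 28 * m + 30.

(* Main.v *)
(* The maximal minors of the matrix with rows [c1 m], [c2 m], [c3 m] are, up to
   sign, the [n_k m]. By Cramer's rule the rows are independent and [n_k m * u]
   lies in [latL m] for every [u] in the kernel. Moreover the ideal generated by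
   the [n_k m] contains [m = n3 m - n2 m] and
   [5 = (n2 m - n1 m) - (m + 4) (n3 m - n2 m)], so the gcd divides [gcd(m, 5)],
   and when [5] does not divide [m] a Bezout relation puts [u] itself in
   [latL m]. *)

Require Import Defs.
From mathcomp Require Import all_boot all_order all_algebra.
From mathcomp Require Import zify ring.
Import GRing.Theory.
Local Open Scope ring_scope.

Lemma vec4_coords (u : 'rV[int]_4) : u = vec4 (u 0 0) (u 0 1) (u 0 2) (u 0 3).
Proof.
apply/rowP=> j; rewrite mxE.
by case: j => [[|[|[|[|]]]] // jP] /=; congr (u 0 _); apply: val_inj.
Qed.

Lemma vec4_inj x1 x2 x3 x4 y1 y2 y3 y4 :
  vec4 x1 x2 x3 x4 = vec4 y1 y2 y3 y4 -> [/\ x1 = y1, x2 = y2, x3 = y3 & x4 = y4].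
Proof.
move=> /rowP E.
by move: (E 0) (E 1) (E 2) (E 3); rewrite !mxE.
Qed.

Lemma vec4D x1 x2 x3 x4 y1 y2 y3 y4 :
  vec4 x1 x2 x3 x4 + vec4 y1 y2 y3 y4
  = vec4 (x1 + y1) (x2 + y2) (x3 + y3) (x4 + y4).
Proof. by apply/rowP=> -[[|[|[|[|]]]] // jP]; rewrite !mxE. Qed.

Lemma vec4Mz x1 x2 x3 x4 a :
  vec4 x1 x2 x3 x4 *~ a = vec4 (x1 * a) (x2 * a) (x3 * a) (x4 * a).
Proof.
by apply/rowP=> -[[|[|[|[|]]]] // jP]; rewrite -scaler_int !mxE /= intz mulrC.
Qed.

Lemma kerZ_vec4 n1 n2 n3 n4 u1 u2 u3 u4 :
  kerZ n1 n2 n3 n4 (vec4 u1 u2 u3 u4)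
  <-> u1 * n1 + u2 * n2 + u3 * n3 + u4 * n4 = 0.
Proof. by rewrite /kerZ !big_ord_recr big_ord0 /= !mxE /= add0r. Qed.

Lemma inIntSpan_lin (V : zmodType) r (s : r.-tuple V) u v (a b : int) :
  inIntSpan s u -> inIntSpan s v -> inIntSpan s (u *~ a + v *~ b).
Proof.
move=> [x ->] [y ->]; exists [ffun i => x i * a + y i * b].
rewrite !mulrz_suml -big_split; apply: eq_bigr => i _ /=.
by rewrite ffunE mulrzDr !mulrzA.
Qed.

Lemma inIntSpan3P (V : zmodType) (d1 d2 d3 v : V) :
  inIntSpan [tuple d1; d2; d3] v
  <-> exists x y z : int, v = d1 *~ x + d2 *~ y + d3 *~ z.
Proof.
split=> [[a ->] | [x [y [z ->]]]].
  exists (a ord0), (a (lift ord0 ord0)), (a (lift ord0 (lift ord0 ord0))).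
  by rewrite !big_ord_recl big_ord0 /= addr0 addrA.
exists [ffun i : 'I_3 => [:: x; y; z]`_i].
by rewrite !big_ord_recl big_ord0 !ffunE /= addr0 addrA.
Qed.

(** In coordinates, membership becomes four polynomial equations, which [ring] settles once the
    coefficients are given. *)
Lemma latL_vec4 m u1 u2 u3 u4 :
  latL m (vec4 u1 u2 u3 u4) <->
  exists x y z : int,
    [/\ u1 = (m + 4) * x + (- (m + 1)) * y + (- 1) * z,
        u2 = (- (m + 1)) * x + (- 3) * y + (m + 3) * z,
        u3 = (- 1) * x + (- 1) * y + (- (m + 1)) * z &
        u4 = (- 1) * x + (m + 4) * y + (- 1) * z].
Proof.
rewrite /latL inIntSpan3P.
split=> -[x [y [z]]]; last first.
  by case=> -> -> -> ->; exists x, y, z; rewrite !vec4Mz !vec4D.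
by rewrite !vec4Mz !vec4D => /vec4_inj ?; exists x, y, z.
Qed.

(** The arguments are listed row by row; the expansion along the first row is a polynomial that
    [ring] can handle. *)
Definition det3 (a1 a2 a3 b1 b2 b3 c1 c2 c3 : int) : int :=
  a1 * (b2 * c3 - b3 * c2) - a2 * (b1 * c3 - b3 * c1) + a3 * (b1 * c2 - b2 * c1).

(** Cramer's rule: replacing one row by the combination of all rows with coefficients [x], [y], [z]
    multiplies the determinant by the coefficient of that row. If the combination vanishes, so do
    these products. *)
Lemma det3_free (a1 a2 a3 b1 b2 b3 c1 c2 c3 x y z : int) :
  det3 a1 a2 a3 b1 b2 b3 c1 c2 c3 != 0 ->
  a1 * x + b1 * y + c1 * z = 0 -> a2 * x + b2 * y + c2 * z = 0 ->
  a3 * x + b3 * y + c3 * z = 0 -> [/\ x = 0, y = 0 & z = 0].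
Proof.
set e1 := _ + _ + c1 * z; set e2 := _ + _ + c2 * z; set e3 := _ + _ + c3 * z.
set d := det3 _ _ _ _ _ _ _ _ _ => d0 E1 E2 E3.
have dx : d * x = det3 e1 e2 e3 b1 b2 b3 c1 c2 c3.
  by rewrite /d /e1 /e2 /e3 /det3; ring.
have dy : d * y = det3 a1 a2 a3 e1 e2 e3 c1 c2 c3.
  by rewrite /d /e1 /e2 /e3 /det3; ring.
have dz : d * z = det3 a1 a2 a3 b1 b2 b3 e1 e2 e3.
  by rewrite /d /e1 /e2 /e3 /det3; ring.
rewrite E1 E2 E3 in dx dy dz.
split; apply: (mulfI d0); rewrite ?dx ?dy ?dz /det3; ring.
Qed.

Lemma latL_sub_kerZ m u : latL m u -> kerZ (n1 m) (n2 m) (n3 m) (n4 m) u.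
Proof.
rewrite (vec4_coords u) latL_vec4 kerZ_vec4 /n1 /n2 /n3 /n4.
by move=> [x [y [z [-> -> -> ->]]]]; ring.
Qed.

Lemma latL_n1 m u : kerZ (n1 m) (n2 m) (n3 m) (n4 m) u -> latL m (u *~ n1 m).
Proof.
rewrite (vec4_coords u) vec4Mz kerZ_vec4 latL_vec4.
move: (u 0 0) (u 0 1) (u 0 2) (u 0 3) => u1 u2 u3 u4 /eqP.
rewrite -!addrA addr_eq0 => /eqP ->.
(* Cramer numerators for coordinates 2, 3, 4; the minus signs arise because that minor is [- n1 m].
   Coordinate 1 then follows from the kernel equation. *)
exists (- det3 u2 u3 u4 (- 3) (- 1) (m + 4) (m + 3) (- (m + 1)) (- 1)).
exists (- det3 (- (m + 1)) (- 1) (- 1) u2 u3 u4 (m + 3) (- (m + 1)) (- 1)).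
exists (- det3 (- (m + 1)) (- 1) (- 1) (- 3) (- 1) (m + 4) u2 u3 u4).
by rewrite /det3 /n1 /n2 /n3 /n4; split; ring.
Qed.

Lemma latL_n2 m u : kerZ (n1 m) (n2 m) (n3 m) (n4 m) u -> latL m (u *~ n2 m).
Proof.
rewrite (vec4_coords u) vec4Mz kerZ_vec4 latL_vec4.
move: (u 0 0) (u 0 1) (u 0 2) (u 0 3) => u1 u2 u3 u4 /eqP.
rewrite -!addrA addrCA addr_eq0 => /eqP ->.
(* Now coordinate 2 is dropped, and the minor is [n2 m] itself, so no sign appears. *)
exists (det3 u1 u3 u4 (- (m + 1)) (- 1) (m + 4) (- 1) (- (m + 1)) (- 1)).
exists (det3 (m + 4) (- 1) (- 1) u1 u3 u4 (- 1) (- (m + 1)) (- 1)).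
exists (det3 (m + 4) (- 1) (- 1) (- (m + 1)) (- 1) (m + 4) u1 u3 u4).
by rewrite /det3 /n1 /n2 /n3 /n4; split; ring.
Qed.

Lemma latL_n3 m u : kerZ (n1 m) (n2 m) (n3 m) (n4 m) u -> latL m (u *~ n3 m).
Proof.
rewrite (vec4_coords u) vec4Mz kerZ_vec4 latL_vec4.
move: (u 0 0) (u 0 1) (u 0 2) (u 0 3) => u1 u2 u3 u4 /eqP.
rewrite addrAC addrC addr_eq0 => /eqP ->.
(* With coordinate 3 dropped, the minor is [- n3 m]. *)
exists (- det3 u1 u2 u4 (- (m + 1)) (- 3) (m + 4) (- 1) (m + 3) (- 1)).
exists (- det3 (m + 4) (- (m + 1)) (- 1) u1 u2 u4 (- 1) (m + 3) (- 1)).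
exists (- det3 (m + 4) (- (m + 1)) (- 1) (- (m + 1)) (- 3) (m + 4) u1 u2 u4).
by rewrite /det3 /n1 /n2 /n3 /n4; split; ring.
Qed.

(** This rests on [n2 m - n1 m = (m + 4) * m + 5]. The bracketing is the order in which
    [kerZ_sub_latL] combines the multiples of [u]. *)
Lemma five_in_ideal (m : int) :
  n2 m * (m + 5) - (n1 m + n3 m * (m + 4)) = 5.
Proof. by rewrite /n1 /n2 /n3; ring. Qed.

Lemma n3_sub_n2 (m : int) : n3 m - n2 m = m.
Proof. by rewrite /n2 /n3; ring. Qed.

Lemma coprimez5 (m : int) : ~~ (5 %| m)%Z -> coprimez m 5.
Proof.
move=> m5; rewrite coprimez_sym /coprimez /gcdz eqz_nat.
by rewrite -/(coprime _ _) prime_coprime.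
Qed.

Lemma kerZ_sub_latL m u : ~~ (5 %| m)%Z ->
  kerZ (n1 m) (n2 m) (n3 m) (n4 m) u -> latL m u.
Proof.
move=> /coprimez5/coprimezP[[a b] /= ab] ker_u.
have Lm : latL m (u *~ m).
  have := @inIntSpan_lin _ _ _ _ _ 1 (- 1) (latL_n3 _ _ ker_u) (latL_n2 _ _ ker_u).
  by rewrite -!mulrzA -mulrzDr mulr1 mulrN1 n3_sub_n2.
have L5 : latL m (u *~ 5).
  have := @inIntSpan_lin _ _ _ _ _ 1 (m + 4) (latL_n1 _ _ ker_u) (latL_n3 _ _ ker_u).
  move/(@inIntSpan_lin _ _ _ _ _ (m + 5) (- 1) (latL_n2 _ _ ker_u)).
  by rewrite -!mulrzA -mulrzDr -mulrzA -mulrzDr mulr1 mulrN1 five_in_ideal.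
(* The Bezout relation [a * m + b * 5 = 1] recovers [u] from [u *~ m] and [u *~ 5]. *)
have := @inIntSpan_lin _ _ _ _ _ a b Lm L5.
by rewrite -!mulrzA -mulrzDr mulrC [5 * b]mulrC ab.
Qed.

Lemma gcdz_n1234 (m : int) :
  gcdz (gcdz (gcdz (n1 m) (n2 m)) (n3 m)) (n4 m)
  = (if (5 %| m)%Z then 5 else 1).
Proof.
set g := gcdz _ _.
have [g1 g2 g3] : [/\ (g %| n1 m)%Z, (g %| n2 m)%Z & (g %| n3 m)%Z].
  have : (g %| g)%Z := dvdzz g.
  by rewrite {2}/g !dvdz_gcd => /andP[/andP[/andP[]]].
have gm : (g %| m)%Z by rewrite -(n3_sub_n2 m) rpredB.
have g5 : (g %| 5%R)%Z.
  rewrite -(five_in_ideal m).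
  by apply: rpredB; [|apply: rpredD => //]; apply: dvdz_mulr.
have g_ge0 : 0 <= g by [].
(* As [g] is nonnegative, the equality can be decided in the naturals, where mutual divisibility
   suffices. *)
apply/eqP; rewrite -[g]gez0_abs //.
case: ifPn => m5.
  have : (5 %| g)%Z.
    (* Substituting [m = 5 * q] makes every coefficient divisible by 5; the witnesses are the
       quotients. *)
    rewrite /g; case/dvdzP: m5 => q ->; rewrite !dvdz_gcd /n1 /n2 /n3 /n4.
    by rewrite -!andbA; apply/and4P; split; apply/dvdzP;
       [exists (25 * q ^+ 3 + 35 * q ^+ 2 + 21 * q + 4)
       |exists (25 * q ^+ 3 + 40 * q ^+ 2 + 25 * q + 5)
       |exists (25 * q ^+ 3 + 40 * q ^+ 2 + 26 * q + 5)
       |exists (25 * q ^+ 3 + 40 * q ^+ 2 + 28 * q + 6)]; ring.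
  by move=> dv; rewrite eqz_nat eqn_dvd; apply/andP.
have : (g %| gcdz m 5)%Z by rewrite dvdz_gcd gm.
by rewrite (eqP (coprimez5 _ m5)) dvdz1 => /eqP->.
Qed.

Lemma latL_free (m : int) (a : int ^ 3) : 1 <= m ->
  \sum_(i < 3) [tuple c1 m; c2 m; c3 m]`_i *~ a i = 0 -> forall i, a i = 0.
Proof.
move=> hm; rewrite !big_ord_recl big_ord0 /= addr0 addrA.
have -> : (0 : 'rV[int]_4) = vec4 0 0 0 0.
  by apply/rowP=> -[[|[|[|[|]]]] // jP]; rewrite !mxE.
rewrite !vec4Mz !vec4D => /vec4_inj [_ E2 E3 E4].
(* Coordinates 2, 3, 4 form a square system of determinant [- n1 m], nonzero because [n1 m] is
   positive for [m >= 1]. *)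
have [|x0 y0 z0] := @det3_free _ _ _ _ _ _ _ _ _ _ _ _ _ E2 E3 E4.
  suff : n1 m != 0 by rewrite -oppr_eq0; congr (_ != _); rewrite /n1 /det3; ring.
  by rewrite /n1; nia.
case=> [[|[|[|]]] // iP]; [move: x0 | move: y0 | move: z0] => <-;
  by congr (a _); apply: val_inj.
Qed.

Theorem proposition3p4 (m : int) (hm : 1 <= m) :
  [/\ gcdz (gcdz (gcdz (n1 m) (n2 m)) (n3 m)) (n4 m)
        = (if (5 %| m)%Z then 5 else 1),
      admissible_basis (latL m) (c1 m) (c2 m) (c3 m) &
      ~~ (5 %| m)%Z ->
        forall u : 'rV[int]_4,
          latL m u <-> kerZ (n1 m) (n2 m) (n3 m) (n4 m) u].
Proof.
split; first exact: gcdz_n1234.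
  split; first by split=> // a; apply: latL_free.
  (* The absolute values of the entries, row by row. In (II), [3 < m + 3] is where [m >= 1]
     enters. *)
  exists (m + 4), (m + 1), 1, 1, (m + 1), 3, 1, (m + 4), 1, (m + 3), (m + 1), 1.
  split=> //=; lia.
move=> m5 u; split; first exact: latL_sub_kerZ.
exact: kerZ_sub_latL.
Qed.
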